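(* Let $\mathcal T\in\mathbb R^{n^{\times d}}_{ps,+}$. Then the function $s\mapsto\rho(\mathcal T^{\circ s})^{1/s}$ is nonincreasing on $(0,\infty)$.
   Context: Let $n\ge1$, $d\ge3$ be integers, $[n]=\{1,\dots,n\}$. $\mathbb R^{n^{\times d}}_{ps,+}$ is the set of tensors $\mathcal T=[t_{i_1,\dots,i_d}]$, $i_1,\dots,i_d\in[n]$, with nonnegative real entries symmetric in the last $d-1$ indices. For $x\in\mathbb C^n$, $\mathcal T(x)_i=\sum_{i_2,\dots,i_d\in[n]}t_{i,i_2,\dots,i_d}x_{i_2}\cdots x_{i_d}$, and $x^{\circ p}=(x_1^p,\dots,x_n^p)^\top$. An eigenvalue of $\mathcal T$ is $\lambda\in\mathbb C$ with $\mathcal T(x)=\lambda x^{\circ(d-1)}$ for some nonzero $x\in\mathbb C^n$; $\rho(\mathcal T)$ is the maximum modulus of the eigenvalues. For $s>0$, $\mathcal T^{\circ s}=[t_{i_1,\dots,i_d}^s]$ is the entrywise power. *)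

(* Defs.v *)
From mathcomp Require Import all_boot all_order all_algebra.
From mathcomp Require Import all_classical all_reals all_analysis.
From mathcomp Require Import complex.

Set Implicit Arguments.
Unset Strict Implicit.
Unset Printing Implicit Defensive.

Import Order.TTheory GRing.Theory Num.Theory.

Local Open Scope classical_set_scope.
Local Open Scope ring_scope.
Local Open Scope complex_scope.

(* [T i J] is the entry t_{i, i_2, ..., i_d} with J = (i_2, ..., i_d); the
   first index is kept apart because symmetry only concerns the others. *)
Definition tensor (R : Type) (n d : nat) : Type :=
  'I_n -> d.-1.-tuple 'I_n -> R.

Definition partially_symmetric (R : Type) (n d : nat) (T : tensor R n d) : Prop :=
  forall (i : 'I_n) (J K : d.-1.-tuple 'I_n), perm_eq J K -> T i J = T i K.

Definition nonneg_tensor (R : realType) (n d : nat) (T : tensor R n d) : Prop :=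
  forall i J, 0 <= T i J.

Definition tensor_app (R : realType) (n d : nat) (T : tensor R n d)
    (x : 'cV[R[i]]_n) : 'cV[R[i]]_n :=
  \col_i \sum_(J : d.-1.-tuple 'I_n) (T i J)%:C * \prod_(j <- J) x j 0.

Definition hadamard_exp (R : realType) (n : nat) (x : 'cV[R[i]]_n) (p : nat) :
    'cV[R[i]]_n :=
  map_mx (fun z => z ^+ p) x.

Definition tensor_eigenvalue (R : realType) (n d : nat) (T : tensor R n d)
    (lambda : R[i]) : Prop :=
  exists2 x : 'cV[R[i]]_n,
    x != 0 & tensor_app T x = lambda *: hadamard_exp x d.-1.

Definition eigenvalue_moduli (R : realType) (n d : nat) (T : tensor R n d) :
    set R :=
  [set Normc.normc lambda | lambda in [set l | tensor_eigenvalue T l]].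

(* The value 0 is only used when the set of moduli has no greatest element. *)
Definition spectral_radius (R : realType) (n d : nat) (T : tensor R n d) : R :=
  xget 0 (eigenvalue_moduli T `&` ubound (eigenvalue_moduli T)).

Lemma spectral_radiusE (R : realType) (n d : nat) (T : tensor R n d) (r : R) :
  eigenvalue_moduli T r -> ubound (eigenvalue_moduli T) r ->
  spectral_radius T = r.
Proof.
move=> Tr ubr; apply: xget_unique => // r' [Tr' ubr'].
by apply/le_anti; rewrite ubr// ubr'.
Qed.

(* For s > 0 a zero entry stays zero, since 0 `^ s = 0 when s != 0. *)
Definition tensor_powR (R : realType) (n d : nat) (T : tensor R n d) (s : R) :
    tensor R n d :=
  fun i J => T i J `^ s.

(* Main.v *)
(** Let [p = d - 1]. The largest [r] with [r x^p <= T(x)] for some nonzero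
    [x >= 0] is attained, by compactness, and it bounds the modulus of every
    eigenvalue [l], since [|l| |x|^p <= T(|x|)] for an eigenvector [x]. It is
    itself an eigenvalue: this holds for the strictly monotone perturbation
    [T(x)_i + e * sum_j x_j^p], and passes to the limit [e -> 0]. Hence the
    spectral radius is this maximum. If [s <= t], [q = s / t] and [x] is a
    nonnegative eigenvector of the [t]-th entrywise power for its spectral
    radius [r], then subadditivity of [u |-> u^q] gives
    [r^q (x^q)^p <= T^s(x^q)], so [r^q] is at most the spectral radius of the
    [s]-th entrywise power. *)
Require Import Defs.
From mathcomp Require Import all_boot all_order all_algebra.
From mathcomp Require Import all_classical all_reals all_analysis.
From mathcomp Require Import complex.

Set Implicit Arguments.
Unset Strict Implicit.
Unset Printing Implicit Defensive.

Import Order.TTheory GRing.Theory Num.Theory.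
Import numFieldNormedType.Exports.

Local Open Scope classical_set_scope.
Local Open Scope ring_scope.

(** * Monotone homogeneous maps and sub-eigenvectors *)

Definition nonneg_vec (R : realType) n (x : 'rV[R]_n) : Prop :=
  forall i, 0 <= x 0 i.

Definition sub_eigenvector (R : realType) n (p : nat)
    (F : 'rV[R]_n -> 'I_n -> R) (r : R) (x : 'rV[R]_n) : Prop :=
  forall i, r * x 0 i ^+ p <= F x i.

(** Stated for abstract maps so that the existence argument applies both to the map of a tensor and
    to its perturbations. *)
Record monotone_homogeneous (R : realType) n (p : nat)
    (F : 'rV[R]_n -> 'I_n -> R) : Prop := MonotoneHomogeneous {
  mh_continuous : forall i, continuous (fun x => F x i);
  mh_ge0 : forall x i, nonneg_vec x -> 0 <= F x i;
  mh_mono : forall (x y : 'rV[R]_n) i, nonneg_vec x -> (forall j, x 0 j <= y 0 j) ->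
    F x i <= F y i;
  mh_homo : forall a (x : 'rV[R]_n) i, 0 <= a -> F (a *: x) i = a ^+ p * F x i }.

Lemma powR_invnK (R : realType) (p : nat) (a : R) :
  (0 < p)%N -> 0 <= a -> (a `^ p%:R^-1) ^+ p = a.
Proof.
move=> p0 a0; rewrite -powR_mulrn ?powR_ge0// -powRrM mulVf ?powRr1//.
by rewrite pnatr_eq0 -lt0n.
Qed.

(** * The Collatz-Wielandt maximum and its eigenvector *)

Section CollatzWielandt.
Variables (R : realType) (n p : nat).
Hypotheses (n_gt0 : (0 < n)%N) (p_gt0 : (0 < p)%N).
Implicit Types (F : 'rV[R]_n -> 'I_n -> R) (x y : 'rV[R]_n) (r : R).

Let psum x := \sum_i x 0 i ^+ p.

(** The nonnegative part of the unit sphere of the p-norm. The exponent [p] matches the degree of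
    [F], so adding a multiple of [psum] keeps homogeneity. *)
Let simplex := [set x | nonneg_vec x /\ psum x = 1].

Let coordX_continuous i : continuous (fun x : 'rV[R]_n => x 0 i ^+ p).
Proof.
move=> x; apply: (@continuous_comp _ _ _ (fun x : 'rV[R]_n => x 0 i)
  (fun t : R => t ^+ p)); first exact: coord_continuous.
exact: exprn_continuous.
Qed.

Let psum_continuous : continuous psum.
Proof.
apply: continuous_big => [|i _]; last exact: coordX_continuous.
exact: add_continuous.
Qed.

Let simplex_le1 x i : simplex x -> x 0 i <= 1.
Proof.
move=> [x0 x1]; rewrite -(@ler_pXn2r _ p)// ?nnegrE// expr1n -x1 /psum.
by rewrite (bigD1 i)//= lerDl sumr_ge0// => j _; rewrite exprn_ge0.
Qed.

Let simplex_compact : compact simplex.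
Proof.
have cube : compact [set x : 'rV[R]_n | forall i, `[0, 1]%classic (x ord0 i)].
  by apply: (@rV_compact R n (fun=> `[0, 1]%classic)) => _; exact: segment_compact.
apply: subclosed_compact cube _ => [|x xS i /=]; last first.
  by rewrite in_itv/= (simplex_le1 i xS) andbT; exact: xS.1.
rewrite (_ : simplex = (\bigcap_(i in setT) ((fun x => x 0 i) @^-1` [set t | 0 <= t]))
    `&` psum @^-1` [set t | t = 1]).
  apply: closedI.
    apply: closed_bigI => i _; apply: preimage_closed => [x _|].
      exact: coord_continuous.
    exact: closed_ge.
  apply: preimage_closed => [x _|]; first exact: psum_continuous.
  exact: closed_eq.
apply/seteqP; split=> x [xge0 x1]; split=> // i; last exact: xge0.
by move=> _; exact: xge0.
Qed.

Let normalize x : nonneg_vec x -> x != 0 ->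
  exists2 a : R, 0 < a & simplex (a *: x).
Proof.
move=> x0 xN0.
have s0 : 0 < psum x.
  have sge0 : 0 <= psum x by apply: sumr_ge0 => i _; rewrite exprn_ge0.
  rewrite lt_neqAle sge0 andbT eq_sym; apply: contra xN0 => /eqP s0.
  apply/eqP/rowP => i; rewrite mxE; apply/eqP.
  have := s0; rewrite /psum => /eqP; rewrite psumr_eq0 => [/allP/(_ i)|j _].
    by rewrite mem_index_enum expf_eq0 p_gt0 => /(_ isT)/eqP/eqP.
  by rewrite exprn_ge0.
exists ((psum x)^-1 `^ p%:R^-1); first by rewrite powR_gt0// invr_gt0.
split=> [i|]; first by rewrite mxE mulr_ge0// powR_ge0.
rewrite /psum; under eq_bigr do rewrite mxE exprMn powR_invnK ?invr_ge0 1?ltW//.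
by rewrite -mulr_sumr mulVf// gt_eqF.
Qed.

Let simplex_neq0 x : simplex x -> x != 0.
Proof.
move=> [_ x1]; apply/eqP => xE; have := oner_neq0 R; rewrite -x1 /psum big1 ?eqxx//.
by move=> i _; rewrite xE mxE expr0n gtn_eqF.
Qed.

Let simplex_nonempty : simplex !=set0.
Proof.
have [||a _ ?] := @normalize (const_mx 1); last by exists (a *: const_mx 1).
  by move=> i; rewrite mxE.
apply/eqP => /rowP/(_ (Ordinal n_gt0)); rewrite !mxE => /eqP.
by rewrite oner_eq0.
Qed.

(** Sum the inequalities over [i], using [psum x = 1]. As the entries of [x] are at most 1,
    monotonicity compares [F x] with [F] at the all-ones vector. *)
Let sub_eigenvector_le F r x : monotone_homogeneous p F -> simplex x ->
  sub_eigenvector p F r x -> r <= \sum_i F (const_mx 1) i.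
Proof.
move=> Fmh xS rx; rewrite -[leLHS]mulr1 -{1}xS.2 mulr_sumr.
apply: ler_sum => i _; apply: (le_trans (rx i)).
apply: (mh_mono Fmh _ xS.1) => j; rewrite mxE; exact: simplex_le1.
Qed.

Let residual_continuous F i : monotone_homogeneous p F ->
  continuous (fun z : 'rV[R]_n * R => F z.1 i - z.2 * z.1 0 i ^+ p).
Proof.
move=> Fmh z.
apply: (@continuousB _ _ _ (fun z : 'rV[R]_n * R => F z.1 i)
    (fun z : 'rV[R]_n * R => z.2 * z.1 0 i ^+ p)).
  apply: (@continuous_comp _ _ _ fst (fun x => F x i)); first exact: cvg_fst.
  exact: (mh_continuous Fmh).
apply: (@continuousM _ _ snd (fun z : 'rV[R]_n * R => z.1 0 i ^+ p)).
  exact: cvg_snd.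
apply: (@continuous_comp _ _ _ fst (fun x : 'rV[R]_n => x 0 i ^+ p)).
  exact: cvg_fst.
exact: coordX_continuous.
Qed.

(** Maximize [r] over the pairs [(x, r)] with [x] in the simplex: the bound [M] makes the set of
    such pairs with [0 <= r] compact. Homogeneity allows rescaling any other candidate [y] into the
    simplex. *)
Lemma max_sub_eigenvalue F : monotone_homogeneous p F ->
  exists r x, [/\ 0 <= r, simplex x, sub_eigenvector p F r x &
    forall r' y, nonneg_vec y -> y != 0 -> sub_eigenvector p F r' y -> r' <= r].
Proof.
move=> Fmh; pose M := \sum_i F (const_mx 1) i.
pose C := [set z : 'rV[R]_n * R | simplex z.1 /\ z.2 \in `[0, M] ] `&`
  [set z | sub_eigenvector p F z.2 z.1].
have [|||z zC zmax] := @compact_EVT_max _ R snd C.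
- have [x xS] := simplex_nonempty; exists (x, 0); split=> /=.
    rewrite in_itv/= lexx /M sumr_ge0// => i _.
    by apply: (mh_ge0 Fmh) => j; rewrite mxE.
  by move=> i; rewrite mul0r; exact: (mh_ge0 Fmh _ xS.1).
- apply: compact_closedI.
    rewrite (_ : [set _ | _] = simplex `*` `[0, M]%classic).
      by apply: compact_setX => //; exact: segment_compact.
    by apply/seteqP; split=> -[x r] [].
  rewrite (_ : [set _ | _] = \bigcap_(i in setT)
      ((fun z : 'rV[R]_n * R => F z.1 i - z.2 * z.1 0 i ^+ p) @^-1` [set t | 0 <= t])).
    apply: closed_bigI => i _; apply: preimage_closed => [z _|].
      exact: residual_continuous.
    exact: closed_ge.
  apply/seteqP; split=> z /= zF i; first by move=> _; rewrite /= subr_ge0.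
  by rewrite -subr_ge0; exact: zF.
- by apply: continuous_subspaceT => z; exact: cvg_snd.
move: zC; rewrite inE => -[[zS]]; rewrite in_itv/= => /andP[z0 zM] zF.
exists z.2, z.1; split=> // r' y y0 yN0 yF.
have [r'0|r'0] := ltP r' 0; first exact: le_trans (ltW r'0) z0.
have [a a0 aS] := normalize y0 yN0.
have ayF : sub_eigenvector p F r' (a *: y).
  move=> i; rewrite (mh_homo Fmh) ?(ltW a0)// mxE exprMn mulrCA.
  by rewrite ler_wpM2l ?exprn_ge0 ?(ltW a0).
apply: (zmax (a *: y, r')); rewrite inE; split=> //=; split=> //.
by rewrite in_itv/= r'0 (sub_eigenvector_le Fmh aS ayF).
Qed.

(** The added term has degree [p], is strictly monotone on nonnegative vectors, and is the constant
    [e] on the simplex. *)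
Let perturb F (e : R) x i := F x i + e * psum x.

Let perturb_mh F e : 0 <= e -> monotone_homogeneous p F ->
  monotone_homogeneous p (perturb F e).
Proof.
move=> e0 Fmh; split=> [i|x i x0|x y i x0 xy|a x i a0].
- move=> x; apply: (@continuousD _ _ _ (fun x => F x i) (fun x => e * psum x)).
    exact: (mh_continuous Fmh).
  apply: (@continuousM _ _ (fun=> e) psum); first exact: cst_continuous.
  exact: psum_continuous.
- rewrite addr_ge0 ?(mh_ge0 Fmh)// mulr_ge0// sumr_ge0// => j _.
  exact: exprn_ge0.
- rewrite lerD ?(mh_mono Fmh)// ler_wpM2l// ler_sum// => j _.
  by rewrite lerXn2r ?nnegrE// (le_trans (x0 j)).
- rewrite /perturb (mh_homo Fmh)// mulrDr mulrCA; congr (_ + e * _).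
  by rewrite mulr_sumr; apply: eq_bigr => j _; rewrite mxE exprMn.
Qed.

Let perturb_lt F e x y i : 0 < e -> monotone_homogeneous p F ->
  nonneg_vec x -> (forall j, x 0 j <= y 0 j) -> x != y ->
  perturb F e x i < perturb F e y i.
Proof.
move=> e0 Fmh x0 xy xNy; rewrite /perturb ler_ltD ?(mh_mono Fmh)// ltr_pM2l//.
have [j xyj] : exists j, x 0 j < y 0 j.
  apply/existsP; apply: contraNT xNy; rewrite negb_exists => /forallP nxy.
  by apply/eqP/rowP => j; apply/eqP; rewrite eq_le xy leNgt nxy.
rewrite /psum (bigD1 j)//= [ltRHS](bigD1 j)//= ltr_leD//.
  by rewrite ltrXn2r ?nnegrE// ?(le_trans (x0 j))// -lt0n.
by apply: ler_sum => k _; rewrite lerXn2r ?nnegrE// (le_trans (x0 k)).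
Qed.

(* If x attains the maximal r but is not an eigenvector, then strict
   monotonicity makes G(x)^(1/p) a sub-eigenvector for some r' > r. *)
Let perturb_eigenvector F e : 0 < e -> monotone_homogeneous p F ->
  exists r x, [/\ 0 <= r, simplex x, (forall i, perturb F e x i = r * x 0 i ^+ p) &
    forall r' y, nonneg_vec y -> y != 0 ->
      sub_eigenvector p (perturb F e) r' y -> r' <= r].
Proof.
move=> e0 Fmh; set G := perturb F e.
have Gmh : monotone_homogeneous p G := perturb_mh (ltW e0) Fmh.
have [r [x [r0 xS xG rmax]]] := max_sub_eigenvalue Gmh.
exists r, x; split=> // i.
have G0 j : 0 < G x j.
  by rewrite /G /perturb xS.2 mulr1 ltr_wpDl// (mh_ge0 Fmh)//; exact: xS.1.
pose m := r `^ p%:R^-1.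
have mE : m ^+ p = r by rewrite powR_invnK.
pose y : 'rV_n := \row_j (G x j `^ p%:R^-1).
have y0 j : 0 < y 0 j by rewrite mxE powR_gt0.
have yE j : y 0 j ^+ p = G x j by rewrite mxE powR_invnK ?ltW.
have mx0 : nonneg_vec (m *: x).
  by move=> j; rewrite mxE mulr_ge0 ?powR_ge0//; exact: xS.1.
have mxy j : (m *: x) 0 j <= y 0 j.
  rewrite -(@ler_pXn2r _ p)// ?nnegrE ?(ltW (y0 j))// yE mxE exprMn mE.
  exact: xG.
(* Since [m ^+ p = r], equality of [m *: x] and [y] says that [x] is already an eigenvector. *)
have [mxEy|mxNy] := eqVneq (m *: x) y; first by rewrite -yE -mxEy mxE exprMn mE.
have lt_G j : r * y 0 j ^+ p < G y j.
  by rewrite yE -mE -(mh_homo Gmh) ?powR_ge0//; exact: perturb_lt.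
(* With its least ratio [q k], [y] is a sub-eigenvector, so maximality forces [q k <= r]; but [lt_G]
   makes every ratio exceed [r]. *)
pose q j := G y j / y 0 j ^+ p.
pose k := [arg min_(j < Ordinal n_gt0) q j]%O.
have kmin j : q k <= q j by rewrite /k; case: arg_minP => // ? _; exact.
have : q k <= r.
  apply: (rmax _ y) => [j||j]; first exact: ltW.
  - apply/eqP => yz; have := y0 (Ordinal n_gt0).
    by rewrite yz mxE ltxx.
  - by rewrite -ler_pdivlMr ?exprn_gt0//; exact: kmin.
by rewrite leNgt /q ltr_pdivlMr ?exprn_gt0// lt_G.
Qed.

(** The limit is taken without subsequences: the residual [h] attains its minimum on a compact set
    of pairs that contains eigenpairs of the perturbations for all [e] in (0, 1], so the minimum is
    0. *)
Theorem nonneg_eigenvector F : monotone_homogeneous p F ->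
  exists r x, [/\ 0 <= r, nonneg_vec x /\ x != 0,
    (forall i, F x i = r * x 0 i ^+ p) &
    forall r' y, nonneg_vec y -> y != 0 -> sub_eigenvector p F r' y -> r' <= r].
Proof.
move=> Fmh; have [r [x [r0 xS xF rmax]]] := max_sub_eigenvalue Fmh.
(* For every [e <= 1], this dominates the bound that [sub_eigenvector_le] gives for
   [perturb F e]. *)
pose M := (\sum_i F (const_mx 1) i) + n%:R * psum (const_mx 1).
pose h (z : 'rV[R]_n * R) := \sum_i `|F z.1 i - z.2 * z.1 0 i ^+ p|.
have hcont : continuous h.
  apply: continuous_big => [|i _]; first exact: add_continuous.
  move=> z; apply: (@continuous_comp _ _ _
    (fun z : 'rV[R]_n * R => F z.1 i - z.2 * z.1 0 i ^+ p) Num.norm).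
    exact: residual_continuous.
  exact: norm_continuous.
have approx (e : R) : 0 < e -> e <= 1 ->
    exists2 z, (simplex `*` `[r, M]%classic) z & h z = n%:R * e.
  move=> e0 e1; have [s [y [s0 yS yF smax]]] := perturb_eigenvector e0 Fmh.
  exists (y, s); last first.
    rewrite /h (eq_bigr (fun=> e)) ?sumr_const ?card_ord ?mulr_natl// => i _ /=.
    by rewrite -yF /perturb yS.2 mulr1 opprD addNKr normrN gtr0_norm.
  split=> //=; rewrite in_itv/=; apply/andP; split.
    (* The perturbation only increases [F], so [x] stays a sub-eigenvector for [r]. Keeping [r] as
       lower end of the interval carries maximality over to the limit. *)
    apply: (smax _ x); [exact: xS.1|exact: simplex_neq0|move=> i].
    apply: (le_trans (xF i)); rewrite lerDl mulr_ge0 ?ltW// xS.2.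
    exact: ltr01.
  have := @sub_eigenvector_le _ s _ (perturb_mh (ltW e0) Fmh) yS.
  move=> /(_ _)/le_trans; apply; first by move=> i; rewrite yF.
  rewrite /perturb big_split/= lerD// sumr_const card_ord -[leLHS]mulr_natl.
  rewrite ler_wpM2l// ler_piMl// sumr_ge0// => i _.
  by rewrite mxE exprn_ge0.
have [z0 z0S _] := approx 1 ltr01 (lexx _).
have [|||[y s]] := @compact_EVT_min _ R h (simplex `*` `[r, M]%classic).
- by exists z0.
- by apply: compact_setX => //; exact: segment_compact.
- exact: continuous_subspaceT.
rewrite inE => -[/= yS]; rewrite in_itv/= => /andP[rs _] hmin.
have hge0 : 0 <= h (y, s) by apply: sumr_ge0.
(* The residual h is n * e at the eigenpair of the e-perturbation. *)
have h0 : h (y, s) = 0.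
  apply/eqP; rewrite eq_le hge0 andbT leNgt; apply/negP => hgt0.
  (* Dividing by [n.+1] makes [n * e] strictly smaller than the supposed minimum. *)
  pose e := Num.min 1 (h (y, s) / n.+1%:R).
  have e0 : 0 < e by rewrite lt_min ltr01 divr_gt0.
  have e1 : e <= 1 by rewrite ge_min lexx.
  have [z zS hz] := approx e e0 e1.
  have := hmin z; rewrite inE hz => /(_ zS); apply/negP; rewrite -ltNge.
  rewrite (@lt_le_trans _ _ (n.+1%:R * e))// ?ltr_pM2r ?ltr_nat//.
  by rewrite mulrC -ler_pdivlMr// ge_min lexx orbT.
have yF i : F y i = s * y 0 i ^+ p.
  apply/eqP; rewrite -subr_eq0 -normr_eq0.
  move/eqP : h0; rewrite psumr_eq0// => /allP/(_ i).
  by rewrite mem_index_enum => /(_ isT).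
exists s, y; split=> //.
- exact: le_trans r0 rs.
- by split; [exact: yS.1|exact: simplex_neq0].
- by move=> r' w w0 wN0 wF; apply: le_trans rs; exact: rmax wF.
Qed.

End CollatzWielandt.

(** * The spectral radius of a nonnegative tensor *)

Section NonnegTensor.
Variables (R : realType) (n d : nat).
Hypotheses (n_gt0 : (0 < n)%N) (d_gt1 : (1 < d)%N).
Implicit Types (T : tensor R n d) (x y : 'rV[R]_n).

Definition tensor_rapp T x i : R :=
  \sum_(J : d.-1.-tuple 'I_n) T i J * \prod_(j <- J) x 0 j.

Lemma tensor_rapp_mh T :
  nonneg_tensor T -> monotone_homogeneous d.-1 (tensor_rapp T).
Proof.
move=> T0; split=> [i|x i x0|x y i x0 xy|a x i a0].
- apply: continuous_big => [|J _]; first exact: add_continuous.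
  move=> x; apply: (@continuousM _ _ (fun=> T i J)
    (fun x : 'rV[R]_n => \prod_(j <- J) x 0 j)); first exact: cst_continuous.
  move: x; apply: continuous_big => [|j _]; first exact: mul_continuous.
  exact: coord_continuous.
- by apply: sumr_ge0 => J _; rewrite mulr_ge0// prodr_ge0.
- apply: ler_sum => J _; rewrite ler_wpM2l// ler_prod// => j _.
  by rewrite x0 xy.
- rewrite /tensor_rapp mulr_sumr; apply: eq_bigr => J _.
  under eq_bigr do rewrite mxE.
  by rewrite big_split/= big_const_seq count_predT size_tuple iter_mulr_1 mulrCA.
Qed.

Lemma normc_ge0 (z : R[i]) : 0 <= Normc.normc z.
Proof. by case: z => a b; exact: sqrtr_ge0. Qed.

Lemma normc_real (a : R) : 0 <= a -> Normc.normc (a%:C)%C = a.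
Proof. by move=> a0; rewrite /= expr0n addr0 sqrtr_sqr ger0_norm. Qed.

Lemma normc_prod (I : Type) (s : seq I) (f : I -> R[i]) :
  Normc.normc (\prod_(i <- s) f i) = \prod_(i <- s) Normc.normc (f i).
Proof. exact: (big_morph _ (@Normc.normcM R) (@Normc.normc1 R)). Qed.

Lemma normcX (z : R[i]) m : Normc.normc (z ^+ m) = Normc.normc z ^+ m.
Proof.
by elim: m => [|m IH]; rewrite ?expr0 ?Normc.normc1// !exprS Normc.normcM IH.
Qed.

Lemma normc_sum_le (I : Type) (s : seq I) (f : I -> R[i]) :
  Normc.normc (\sum_(i <- s) f i) <= \sum_(i <- s) Normc.normc (f i).
Proof.
elim: s => [|i s IH]; first by rewrite !big_nil Normc.normc0.
by rewrite !big_cons (le_trans (le_normcD _ _))// lerD2l.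
Qed.

(** Take moduli in the eigenvalue equation and apply the triangle inequality; the witness is the
    vector of moduli. *)
Lemma tensor_eigenvalue_sub T (l : R[i]) : nonneg_tensor T ->
  tensor_eigenvalue T l -> exists y, [/\ nonneg_vec y, y != 0 &
    sub_eigenvector d.-1 (tensor_rapp T) (Normc.normc l) y].
Proof.
move=> T0 [z zN0 zE]; exists (\row_i Normc.normc (z i 0)); split=> [i||i].
- by rewrite mxE normc_ge0.
- apply: contra zN0 => /eqP/rowP y0; apply/eqP/colP => i.
  by have := y0 i; rewrite !mxE => /Normc.eq0_normc.
- rewrite mxE -normcX -Normc.normcM.
  have /colP/(_ i) := zE; rewrite !mxE => <-.
  apply: (le_trans (normc_sum_le _ _)); apply: ler_sum => J _.
  rewrite Normc.normcM normc_real// normc_prod.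
  by under [X in _ <= _ * X]eq_bigr do rewrite mxE.
Qed.

Lemma tensor_eigenvalue_real T (r : R) x : x != 0 ->
  (forall i, tensor_rapp T x i = r * x 0 i ^+ d.-1) ->
  tensor_eigenvalue T (r%:C)%C.
Proof.
move=> xN0 xE; exists (\col_i (x 0 i)%:C%C).
  apply: contra xN0 => /eqP/colP z0; apply/eqP/rowP => i.
  by have := z0 i; rewrite !mxE => -[].
apply/colP => i; rewrite !mxE -rmorphXn -rmorphM -xE rmorph_sum.
apply: eq_bigr => J _; rewrite rmorphM rmorph_prod.
by under eq_bigr do rewrite mxE.
Qed.

(** The maximal [r] is itself an eigenvalue and bounds all moduli, so the set of moduli has a
    greatest element and [spectral_radius] is not its default value. *)
Theorem tensor_perron_frobenius T : nonneg_tensor T ->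
  exists x, [/\ 0 <= spectral_radius T, nonneg_vec x /\ x != 0,
    (forall i, tensor_rapp T x i = spectral_radius T * x 0 i ^+ d.-1) &
    forall r y, nonneg_vec y -> y != 0 ->
      sub_eigenvector d.-1 (tensor_rapp T) r y -> r <= spectral_radius T].
Proof.
move=> T0; have d0 : (0 < d.-1)%N by rewrite -ltnS prednK// ltnW.
have [r [x [r0 [x0 xN0] xE rmax]]] :=
  nonneg_eigenvector n_gt0 d0 (tensor_rapp_mh T0).
suff -> : spectral_radius T = r by exists x.
apply: spectral_radiusE.
  exists (r%:C)%C; first exact: tensor_eigenvalue_real xE.
  exact: normc_real.
move=> _ [l lT <-]; have [y [y0 yN0 yF]] := tensor_eigenvalue_sub T0 lT.
exact: rmax yF.
Qed.

End NonnegTensor.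

(** * Entrywise powers and monotonicity in the exponent *)

Lemma powR_sum_le (R : realType) (I : Type) (s : seq I) (f : I -> R) (q : R) :
  0 < q -> q <= 1 -> (forall i, 0 <= f i) ->
  (\sum_(i <- s) f i) `^ q <= \sum_(i <- s) f i `^ q.
Proof.
move=> q0 q1 f0.
have powRD_le (a b : R) : 0 <= a -> 0 <= b -> (a + b) `^ q <= a `^ q + b `^ q.
  rewrite le_eqVlt => /predU1P[<- _|a0].
    by rewrite add0r powR0 ?gt_eqF// add0r.
  rewrite le_eqVlt => /predU1P[<-|b0].
    by rewrite addr0 powR0 ?gt_eqF// addr0.
  have c0 : 0 < a + b by rewrite addr_gt0.
  (* The ratio [u / (a + b)] lies in (0, 1], so it is at most its own [q]-th power. Adding the cases
     [u = a] and [u = b] gives subadditivity. *)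
  have part (u : R) : 0 < u -> u <= a + b ->
      u / (a + b) * (a + b) `^ q <= u `^ q.
    move=> u0 uc; rewrite -[in leRHS](divfK (lt0r_neq0 c0) u).
    rewrite [leRHS]powRM ?divr_ge0 ?(ltW u0) ?(ltW c0)// ler_wpM2r ?powR_ge0//.
    by rewrite ger1_powR// divr_gt0//= ler_pdivrMr// mul1r.
  rewrite (le_trans _ (lerD (part a _ _) (part b _ _)))//.
  - by rewrite -mulrDl -mulrDl divff ?mul1r// gt_eqF.
  - by rewrite lerDl ltW.
  - by rewrite lerDr ltW.
elim: s => [|i s IH]; first by rewrite !big_nil powR0 ?gt_eqF.
rewrite !big_cons (le_trans (powRD_le _ _ _ _))// ?sumr_ge0//.
by rewrite lerD2l.
Qed.

Lemma powR_prod (R : realType) (I : Type) (s : seq I) (f : I -> R) (q : R) :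
  (forall i, 0 <= f i) ->
  (\prod_(i <- s) f i) `^ q = \prod_(i <- s) f i `^ q.
Proof.
move=> f0; elim: s => [|i s IH]; first by rewrite !big_nil powR1.
by rewrite !big_cons powRM// ?prodr_ge0// IH.
Qed.

(** Raise the inequality to the power [q], which is monotone, then use subadditivity on the sum and
    multiplicativity on each monomial. *)
Lemma sub_eigenvector_powR (R : realType) (n d : nat) (T : tensor R n d)
    (q r : R) (x : 'rV[R]_n) :
  nonneg_tensor T -> 0 < q -> q <= 1 -> 0 <= r -> nonneg_vec x ->
  sub_eigenvector d.-1 (tensor_rapp T) r x ->
  sub_eigenvector d.-1 (tensor_rapp (tensor_powR T q)) (r `^ q)
    (map_mx (@powR R ^~ q) x).
Proof.
move=> T0 q0 q1 r0 x0 xT i; rewrite mxE -powR_mulrn ?powR_ge0// powRAC.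
rewrite powR_mulrn// -powRM ?exprn_ge0//.
have Tx0 J : 0 <= T i J * \prod_(j <- J) x 0 j by rewrite mulr_ge0// prodr_ge0.
apply: (@le_trans _ _ (tensor_rapp T x i `^ q)).
  apply: ge0_ler_powR (xT i); rewrite ?nnegrE ?(ltW q0) ?mulr_ge0 ?exprn_ge0//.
  exact: sumr_ge0.
apply: (le_trans (powR_sum_le _ q0 q1 Tx0)); apply: ler_sum => J _.
rewrite powRM ?prodr_ge0// powR_prod//.
by under [X in _ <= _ * X]eq_bigr do rewrite mxE.
Qed.

Theorem theorem20 (R : realType) (n d : nat) (hn : (1 <= n)%N) (hd : (3 <= d)%N)
    (T : tensor R n d) (Tps : partially_symmetric T) (Tge0 : nonneg_tensor T) :
  {in `]0, +oo[ &, nonincreasing_fun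
    (fun s : R => spectral_radius (tensor_powR T s) `^ s^-1)}.
Proof.
move=> s t; rewrite !in_itv/= !andbT => s0 t0 st.
have T0 u : nonneg_tensor (tensor_powR T u) by move=> i J; exact: powR_ge0.
have [x [rt0 [x0 xN0] xE _]] := tensor_perron_frobenius hn (ltnW hd) (T0 t).
have [_ [rs0 _ _ rs_max]] := tensor_perron_frobenius hn (ltnW hd) (T0 s).
pose q := s / t.
have q0 : 0 < q by rewrite divr_gt0.
have q1 : q <= 1 by rewrite ler_pdivrMr// mul1r.
have Tst : tensor_powR (tensor_powR T t) q = tensor_powR T s.
  apply/funext => i; apply/funext => J.
  by rewrite /tensor_powR -powRrM mulrC divfK ?gt_eqF.
have yT : sub_eigenvector d.-1 (tensor_rapp (tensor_powR T s))
    (spectral_radius (tensor_powR T t) `^ q) (map_mx (@powR R ^~ q) x).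
  rewrite -Tst; apply: sub_eigenvector_powR => // i.
  by rewrite xE.
(* This exposes a common outer exponent [s^-1], leaving only the comparison of the [q]-th power of
   one radius with the other. *)
have -> : t^-1 = q * s^-1 by rewrite mulrAC divff ?mul1r// gt_eqF.
rewrite powRrM; apply: ge0_ler_powR; rewrite ?nnegrE ?powR_ge0 ?invr_ge0 ?(ltW s0)//.
apply: rs_max yT => [i|]; first by rewrite mxE powR_ge0.
apply: contra xN0 => /eqP/rowP y0; apply/eqP/rowP => i.
by have := y0 i; rewrite !mxE => /powR_eq0_eq0.
Qed.
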